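(* Let $\mathbb K$ be any field, let $k$ be a positive integer, and let $\Gamma\subset\mathbb P^{k-1}_{\mathbb K}$ be a finite set of $n$ distinct ($\mathbb K$-rational) points, not all contained in a hyperplane. Assume that $\Gamma$ is $(k-2)$-generic, i.e. any $k-1$ of its points span a hyperplane. Let $\mathcal A_\Gamma$ be the dual arrangement of $n$ hyperplanes in $\mathbb K^k$, with defining linear forms $L_1,\dots,L_n\in R=\mathbb K[x_1,\dots,x_k]$, and let $$I_{n-k+2}(\mathcal A_\Gamma)=\langle\{L_{i_1}\cdots L_{i_{n-k+2}} : 1\le i_1<\cdots<i_{n-k+2}\le n\}\rangle\subset R.$$ Then $$hyp(\Gamma)=nil\big(I_{n-k+2}(\mathcal A_\Gamma)\big)+k-2.$$
   Context: A hyperplane of $\mathbb P^{k-1}_{\mathbb K}$ is the zero set of a nonzero linear form with coefficients in $\mathbb K$. ''Any $k-1$ of the points of $\Gamma$ span a hyperplane'' means that homogeneous coordinate vectors in $\mathbb K^k$ of any $k-1$ distinct points of $\Gamma$ are linearly independent. $hyp(\Gamma)$ denotes the maximum number of points of $\Gamma$ contained in some hyperplane of $\mathbb P^{k-1}_{\mathbb K}$. Dual arrangement: choose homogeneous coordinates $P_i=[a_{i1},\dots,a_{ik}]$ for the points $P_1,\dots,P_n$ of $\Gamma$, and put $L_i=a_{i1}x_1+\cdots+a_{ik}x_k$; $\mathcal A_\Gamma$ is the set of the $n$ hyperplanes $\{L_i=0\}\subset\mathbb K^k$. (The forms $L_i$ are determined up to nonzero scalars, and the ideal $I_{n-k+2}(\mathcal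 A_\Gamma)$ does not depend on the choice.) For an ideal $I\subset R$, the index of nilpotency $nil(I)$ is the smallest integer $s\ge 0$ such that $(\sqrt I)^s\subseteq I$ (with $J^0=R$). *)

(* Defs.v *)
From HB Require Import structures.
From mathcomp Require Import all_boot all_order all_algebra.
From mathcomp Require Import mpoly.

Set Implicit Arguments.
Unset Strict Implicit.
Unset Printing Implicit Defensive.

Import GRing.Theory.
Local Open Scope ring_scope.

(* Ideals are Prop-valued: the ideals of MathComp's ring_quotient are decidable
   and proper, whereas the ones below need be neither. *)
Section Ideals.

Variable R : comNzRingType.
Implicit Types (G I J : R -> Prop) (s : nat).

Definition ideal_gen G : R -> Prop := fun f =>
  exists m (c g : 'I_m -> R), (forall i, G (g i)) /\ f = \sum_i c i * g i.

(* For s = 0 the only generator is the empty product 1, so J^0 = R. *)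
Definition ideal_pow J s : R -> Prop :=
  ideal_gen (fun f =>
    exists g : 'I_s -> R, (forall i, J (g i)) /\ f = \prod_i g i).

Definition ideal_radical I : R -> Prop := fun f => exists m, I (f ^+ m).

Definition nilpotent_at I s : Prop :=
  forall f, ideal_pow (ideal_radical I) s f -> I f.

Definition is_nil I s : Prop :=
  nilpotent_at I s /\ forall t, nilpotent_at I t -> (s <= t)%N.

Lemma is_nil_uniq I s t : is_nil I s -> is_nil I t -> s = t.
Proof.
by move=> [Is mins] [It mint]; apply/eqP; rewrite eqn_leq mins // mint.
Qed.

End Ideals.

Section Points.

Variables (K : fieldType) (k : nat).

(* The K-rational points of P^(k-1): the lines through 0 in K^k. *)
Definition proj : Type := {U : {vspace 'rV[K]_k} | \dim U == 1%N}.

Definition homog_coord (p : proj) (x : 'rV[K]_k) : Prop := val p = <[x]>%VS.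

Definition linear_form : Type := 'Hom('rV[K]_k, K^o).

Definition on_hyperplane (l : linear_form) (p : proj) : bool :=
  (val p <= lker l)%VS.

Section Configuration.

Variables (n : nat) (P : 'I_n -> proj).

Definition in_some_hyperplane : Prop :=
  exists l : linear_form, l != 0 /\ forall i, on_hyperplane l (P i).

(* (k-2)-genericity, where k is positive. *)
Definition generic_km2 : Prop :=
  forall x : 'I_n -> 'rV[K]_k, (forall i, homog_coord (P i) (x i)) ->
  forall S : {set 'I_n}, #|S| = k.-1 -> free [seq x i | i <- enum S].

Definition points_on (l : linear_form) : {set 'I_n} :=
  [set i | on_hyperplane l (P i)].

Definition is_hyp (h : nat) : Prop :=
  (exists l : linear_form, l != 0 /\ #|points_on l| = h) /\
  (forall l : linear_form, l != 0 -> (#|points_on l| <= h)%N).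

Lemma is_hyp_uniq h1 h2 : is_hyp h1 -> is_hyp h2 -> h1 = h2.
Proof.
move=> [[l1 [nz1 <-]] max1] [[l2 [nz2 <-]] max2].
by apply/eqP; rewrite eqn_leq max2 // max1.
Qed.

End Configuration.

Definition dual_form (x : 'rV[K]_k) : {mpoly K[k]} := \sum_j x 0 j *: 'X_j.

Definition fold_ideal n (L : 'I_n -> {mpoly K[k]}) (d : nat) :
    {mpoly K[k]} -> Prop :=
  ideal_gen (fun f =>
    exists S : {set 'I_n}, #|S| = d /\ f = \prod_(i in S) L i).

End Points.

(* Main.v *)
(** For p <> 0 in K^k let m_p be the number of forms L_i vanishing at p, and let
    ord_p f be the order of vanishing of f along the line Kp.  The key fact is
    that the ideal generated by the (n-k+2)-fold products contains every f with
    ord_p f >= m_p - k + 2 for all p (the converse is a count of factors).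
    Restrict f to the hyperplane L_n = 0: by induction on k the restriction is a
    combination of restricted (n-k+2)-fold products of L_1, ..., L_(n-1); lift
    it to K^k and subtract it from f.  What remains is L_n h, where h satisfies
    the order conditions of L_1, ..., L_(n-1), so induction on n applies to h.
    Elements of the radical have order at least 1 along every p with
    m_p >= k - 1, hence s-fold products of them lie in the ideal as soon as
    s >= m_p - k + 2 for all p.  Conversely, at a p with m_p maximal and for
    L_j(p) = 0, the product of L_j and of all L_i with L_i(p) <> 0 lies in the
    radical and has order exactly 1 along p, so none of its t-th powers with
    t < m_p - k + 2 lies in the ideal. *)

From HB Require Import structures.
Require Import Defs.
From mathcomp Require Import all_boot all_order all_algebra.
From mathcomp Require Import mpoly.

Section FoldIdeals.

Set Implicit Arguments.
Unset Strict Implicit.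
Unset Printing Implicit Defensive.

Import GRing.Theory.
Local Open Scope ring_scope.

(** * Generation of polynomial rings by constants and variables *)

Lemma mpoly_ring_ind (K : fieldType) (k : nat) (Q : {mpoly K[k]} -> Prop) :
  (forall c, Q c%:MP) -> (forall j, Q 'X_j) ->
  (forall f g, Q f -> Q g -> Q (f + g)) ->
  (forall f g, Q f -> Q g -> Q (f * g)) -> forall f, Q f.
Proof.
move=> QC QX QD QM f; rewrite [f]mpolyE.
apply: big_ind => [||m _]; [by rewrite -mpolyC0; apply: (QC) | exact: QD |].
rewrite -mul_mpolyC mpolyXE_id; apply: (QM) => //.
apply: big_ind => [||i _]; [by rewrite -mpolyC1; apply: (QC) | exact: QM |].
elim: (m i) => [|e IH]; first by rewrite expr0 -mpolyC1; apply: (QC).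
by rewrite exprS; apply: (QM).
Qed.

Lemma mpoly_rmorphism_ext (K : fieldType) (k : nat) (S : nzRingType)
    (F G : {rmorphism {mpoly K[k]} -> S}) :
  (forall c : K, F c%:MP = G c%:MP) -> (forall j, F 'X_j = G 'X_j) -> F =1 G.
Proof.
move=> eqC eqX; apply: mpoly_ring_ind => // f g Ef Eg.
  by rewrite !rmorphD Ef Eg.
by rewrite !rmorphM Ef Eg.
Qed.

(** * Divisibility by powers of the variable over a domain *)

Section PolyXDivisibility.

Variable A : idomainType.
Implicit Types (u v : {poly A}) (d e : nat).

Definition Xn_dvd u e : Prop := exists q, u = q * 'X^e.

Lemma Xn_dvd0 u : Xn_dvd u 0.
Proof. by exists u; rewrite mulr1. Qed.

Lemma Xn_dvd_poly0 e : Xn_dvd 0 e.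
Proof. by exists 0; rewrite mul0r. Qed.

Lemma Xn_dvd_leq u e e' : (e' <= e)%N -> Xn_dvd u e -> Xn_dvd u e'.
Proof.
by move=> le [q ->]; exists (q * 'X^(e - e')); rewrite -mulrA -exprD subnK.
Qed.

Lemma Xn_dvdD u v e : Xn_dvd u e -> Xn_dvd v e -> Xn_dvd (u + v) e.
Proof. by move=> [q ->] [r ->]; exists (q + r); rewrite mulrDl. Qed.

Lemma Xn_dvdN u e : Xn_dvd u e -> Xn_dvd (- u) e.
Proof. by move=> [q ->]; exists (- q); rewrite mulNr. Qed.

Lemma Xn_dvdM u v d e : Xn_dvd u d -> Xn_dvd v e -> Xn_dvd (u * v) (d + e).
Proof. by move=> [q ->] [r ->]; exists (q * r); rewrite exprD mulrACA. Qed.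

Lemma Xn_dvd1P u : Xn_dvd u 1 <-> u`_0 = 0.
Proof.
split=> [[q ->]|u0]; first by rewrite coefMX.
have: root u 0 by rewrite /root horner_coef0 u0.
by move=> /factor_theorem[q Eq]; exists q; rewrite Eq subr0.
Qed.

Lemma Xn_dvd1_root u m : Xn_dvd (u ^+ m) 1 -> Xn_dvd u 1.
Proof.
move=> /Xn_dvd1P; rewrite -horner_coef0 horner_exp => /eqP.
by rewrite expf_eq0 => /andP[_ /eqP]; rewrite horner_coef0 => /Xn_dvd1P.
Qed.

(** In a domain, the nonzero constant coefficient of [u] forces that of [v] to vanish, so factors
    ['X] split off [v] one at a time. *)
Lemma Xn_dvd_cancel u v e : u`_0 != 0 -> Xn_dvd (u * v) e -> Xn_dvd v e.
Proof.
move=> u0; elim: e v => [|e IH] v; first by move=> _; apply: Xn_dvd0.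
move=> [q E].
have [w Ew] : Xn_dvd v 1.
  apply/Xn_dvd1P/(mulfI u0); rewrite -coef0M E exprSr mulrA coefMX.
  by rewrite mulr0.
have /IH[r Er] : Xn_dvd (u * w) e.
  exists q; apply: (mulIf (negbT (polyX_eq0 A))).
  by rewrite -!mulrA -exprSr -E Ew.
by exists r; rewrite Ew Er -mulrA -exprSr.
Qed.

Lemma Xn_dvd_cancelX (a : A) u e :
  a != 0 -> Xn_dvd (a%:P * 'X * u) e.+1 -> Xn_dvd u e.
Proof.
move=> a0 [q E]; apply: (@Xn_dvd_cancel a%:P); first by rewrite coefC eqxx.
exists q; apply: (mulIf (negbT (polyX_eq0 A))).
by rewrite -[RHS]mulrA -exprSr -E mulrAC.
Qed.

Lemma coef0_prod_neq0 (I : finType) (P : pred I) (F : I -> {poly A}) :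
  (forall i, P i -> (F i)`_0 != 0) -> (\prod_(i | P i) F i)`_0 != 0.
Proof.
move=> F0; rewrite -horner_coef0 horner_prod; apply/prodf_neq0 => i Pi.
by rewrite horner_coef0 F0.
Qed.

Lemma coef0_line (c x : A) :
  ((c *: 'X)%:P + x%:P%:P * 'X : {poly {poly A}})`_0 = c *: 'X.
Proof. by rewrite coefD coefMX coefC addr0. Qed.

Lemma coef0_line_eq0 (c x : A) :
  (((c *: 'X)%:P + x%:P%:P * 'X : {poly {poly A}})`_0 == 0) = (c == 0).
Proof.
by rewrite coef0_line -mul_polyC mulf_eq0 polyX_eq0 orbF polyC_eq0.
Qed.

End PolyXDivisibility.

Lemma polyC_mul_line (A : idomainType) (c d x : A) :
  c%:P%:P * ((d *: 'X)%:P + x%:P%:P * 'X) =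
  ((c * d) *: 'X)%:P + (c * x)%:P%:P * 'X :> {poly {poly A}}.
Proof. by rewrite mulrDr mulrA -!polyCM -scalerA -(mul_polyC c). Qed.

(** * Order of vanishing along a line through the origin *)

Section Order.

Variables (K : fieldType) (k : nat).
Implicit Types (p a : 'rV[K]_k) (f g : {mpoly K[k]}).

(* f(T p + E X) with E the outer and T the inner polynomial variable: the
   indeterminate T makes the expansion one along the whole line K p, even when
   K is finite and f is not homogeneous. *)
Definition line_expansion p :
    {mpoly K[k]} -> {poly {poly {mpoly K[k]}}} :=
  mmap (polyC \o polyC \o @mpolyC k K)
    (fun j => ((p 0 j)%:MP *: 'X)%:P + ('X_j)%:P%:P * 'X).

HB.instance Definition _ p := GRing.RMorphism.copy (line_expansion p)
  (mmap (polyC \o polyC \o @mpolyC k K)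
    (fun j => ((p 0 j)%:MP *: 'X)%:P + ('X_j)%:P%:P * 'X)).

Lemma line_expansionC p (c : K) : line_expansion p c%:MP = c%:MP%:P%:P.
Proof. exact: mmapC. Qed.

Lemma line_expansionX p j :
  line_expansion p 'X_j = ((p 0 j)%:MP *: 'X)%:P + ('X_j)%:P%:P * 'X.
Proof. by rewrite /line_expansion mmapX mmap1U. Qed.

Definition orthv p a : bool := a *m p^T == 0.

Definition order_ge p f (e : nat) : Prop := Xn_dvd (line_expansion p f) e.

Lemma dual_formE a : dual_form a = \sum_j (a 0 j)%:MP * 'X_j.
Proof. by apply: eq_bigr => j _; rewrite mul_mpolyC. Qed.

(** Linearity gives a(T p + E X) = a(p) T + E a(X). The term constant in E thus detects whether the
    form vanishes at [p]; if it does, only E times the form remains. *)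
Lemma line_expansion_dual p a :
  line_expansion p (dual_form a) =
  (((a *m p^T) 0 0)%:MP *: 'X)%:P + (dual_form a)%:P%:P * 'X.
Proof.
rewrite dual_formE rmorph_sum /= mxE.
rewrite !rmorph_sum mulr_suml scaler_suml rmorph_sum -big_split /=.
apply: eq_bigr => j _; rewrite rmorphM /= line_expansionC line_expansionX.
by rewrite [LHS]polyC_mul_line [p^T _ _]mxE mpolyCM.
Qed.

Lemma dual_form_neq0 a : a != 0 -> dual_form a != 0.
Proof.
apply: contraNneq => La0; apply/eqP/rowP => j; rewrite mxE.
have /(congr1 (mcoeff U_(j))) := La0; rewrite mcoeff0 /dual_form raddf_sum /=.
rewrite (bigD1 j) //= mcoeffZ mcoeffXU eqxx mulr1 big1 ?addr0 // => i ij.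
by rewrite mcoeffZ mcoeffXU (negbTE ij) mulr0.
Qed.

Lemma order_ge0 p f : order_ge p f 0.
Proof. exact: Xn_dvd0. Qed.

Lemma order_ge_poly0 p e : order_ge p 0 e.
Proof. by rewrite /order_ge rmorph0; apply: Xn_dvd_poly0. Qed.

Lemma order_ge_leq p f e e' : (e' <= e)%N -> order_ge p f e -> order_ge p f e'.
Proof. exact: Xn_dvd_leq. Qed.

Lemma order_geD p f g e :
  order_ge p f e -> order_ge p g e -> order_ge p (f + g) e.
Proof. by rewrite /order_ge rmorphD; apply: Xn_dvdD. Qed.

Lemma order_geN p f e : order_ge p f e -> order_ge p (- f) e.
Proof. by rewrite /order_ge rmorphN; apply: Xn_dvdN. Qed.

Lemma order_geM p f g d e :
  order_ge p f d -> order_ge p g e -> order_ge p (f * g) (d + e).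
Proof. by rewrite /order_ge rmorphM; apply: Xn_dvdM. Qed.

Lemma order_ge_mull p f g e : order_ge p g e -> order_ge p (f * g) e.
Proof. exact: order_geM (order_ge0 p f). Qed.

Lemma order_ge_prod p (I : finType) (P : pred I) (F : I -> {mpoly K[k]})
    (e : I -> nat) :
  (forall i, P i -> order_ge p (F i) (e i)) ->
  order_ge p (\prod_(i | P i) F i) (\sum_(i | P i) e i).
Proof.
move=> FE; elim/big_rec2: _ => [|i d f Pi IH]; first exact: order_ge0.
exact: order_geM (FE i Pi) IH.
Qed.

Lemma order_ge_prod1 p m (F : 'I_m -> {mpoly K[k]}) :
  (forall i, order_ge p (F i) 1) -> order_ge p (\prod_i F i) m.
Proof.
move=> F1; have := order_ge_prod (P := xpredT) (e := fun=> 1%N) (fun i _ => F1 i).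
by rewrite sum1_card card_ord.
Qed.

Lemma order_ge1_root p f m : order_ge p (f ^+ m) 1 -> order_ge p f 1.
Proof. by rewrite /order_ge rmorphXn; apply: Xn_dvd1_root. Qed.

Lemma order_ge_dual p a : orthv p a -> order_ge p (dual_form a) 1.
Proof.
move=> /eqP pa; apply/Xn_dvd1P.
by rewrite line_expansion_dual coef0_line pa mxE mpolyC0 scale0r.
Qed.

Lemma line_expansion_dual_neq0 p a :
  ~~ orthv p a -> (line_expansion p (dual_form a))`_0 != 0.
Proof.
move=> pa; rewrite line_expansion_dual coef0_line_eq0 mpolyC_eq0.
apply: contra pa => /eqP pa.
by apply/eqP/matrixP => i j; rewrite !ord1 pa mxE.
Qed.

Lemma order_ge_cancel p a f e :
  ~~ orthv p a -> order_ge p (dual_form a * f) e -> order_ge p f e.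
Proof.
rewrite /order_ge rmorphM => /line_expansion_dual_neq0 pa.
exact: Xn_dvd_cancel.
Qed.

Lemma order_ge_cancel_orth p a f e : a != 0 -> orthv p a ->
  order_ge p (dual_form a * f) e.+1 -> order_ge p f e.
Proof.
move=> a0 /eqP pa; rewrite /order_ge rmorphM /= line_expansion_dual pa mxE.
rewrite mpolyC0 scale0r add0r; apply: Xn_dvd_cancelX.
by rewrite polyC_eq0 dual_form_neq0.
Qed.

(** If no factor vanished at [p], all constant terms in E would be nonzero, and so would their
    product in a domain. *)
Lemma order_ge_prod_dual p (I : finType) (P : pred I) (x : I -> 'rV_k) :
  order_ge p (\prod_(i | P i) dual_form (x i)) 1 ->
  exists2 i, P i & orthv p (x i).
Proof.
have [/existsP[i /andP[Pi pi]] _|none] := boolP [exists i, P i && orthv p (x i)].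
  by exists i.
move=> /Xn_dvd1P; rewrite rmorph_prod => E.
have : (\prod_(i | P i) line_expansion p (dual_form (x i)))`_0 != 0.
  apply: coef0_prod_neq0 => i Pi; apply: line_expansion_dual_neq0.
  by apply: contra none => pi; apply/existsP; exists i; rewrite Pi.
by rewrite E eqxx.
Qed.

End Order.

(** * Linear substitutions and restriction to a hyperplane *)

Section LinearSubstitution.

Variable K : fieldType.

(** This is the pullback of polynomial functions along the linear map sending [p] to [p *m B^T]. *)
Definition lin_subst (m k : nat) (B : 'M[K]_(m, k)) :
    {mpoly K[m]} -> {mpoly K[k]} :=
  mmap (@mpolyC k K) (fun j => dual_form (row j B)).

HB.instance Definition _ m k B := GRing.RMorphism.copy (@lin_subst m k B)
  (mmap (@mpolyC k K) (fun j => dual_form (row j B))).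

Lemma lin_substC m k (B : 'M[K]_(m, k)) (c : K) : lin_subst B c%:MP = c%:MP.
Proof. exact: mmapC. Qed.

Lemma lin_substX m k (B : 'M[K]_(m, k)) j :
  lin_subst B 'X_j = dual_form (row j B).
Proof. by rewrite /lin_subst mmapX mmap1U. Qed.

Lemma lin_subst_dual m k (B : 'M[K]_(m, k)) (a : 'rV_m) :
  lin_subst B (dual_form a) = dual_form (a *m B).
Proof.
rewrite dual_formE rmorph_sum /dual_form /=.
under eq_bigr => j _.
  rewrite rmorphM /= lin_substC lin_substX mul_mpolyC /dual_form scaler_sumr.
  under eq_bigr => i _ do rewrite scalerA mxE.
  over.
rewrite exchange_big; apply: eq_bigr => i _.
by rewrite mxE scaler_suml.
Qed.

(** Both sides expand f(B(T p + E X)); as ring morphisms in [f] they need only be compared on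
    constants and variables. *)
Lemma line_expansion_subst m k (B : 'M[K]_(m, k)) p f :
  line_expansion p (lin_subst B f) =
  map_poly (map_poly (lin_subst B)) (line_expansion (p *m B^T) f).
Proof.
apply: (mpoly_rmorphism_ext
  (F := line_expansion p \o lin_subst B)
  (G := map_poly (map_poly (lin_subst B)) \o line_expansion (p *m B^T))) => [c|j] /=.
  by rewrite lin_substC !line_expansionC map_polyC /= map_polyC /= lin_substC.
rewrite lin_substX line_expansion_dual line_expansionX rmorphD rmorphM /=.
rewrite map_polyC /= map_polyC /= map_polyZ /= map_polyX map_polyX.
rewrite map_polyC /= lin_substX lin_substC; congr ((_%:MP *: _)%:P + _); rewrite !mxE.
by apply: eq_bigr => i _; rewrite !mxE mulrC.
Qed.

Lemma order_ge_subst m k (B : 'M[K]_(m, k)) p f e :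
  order_ge (p *m B^T) f e -> order_ge p (lin_subst B f) e.
Proof.
move=> [q Eq]; exists (map_poly (map_poly (lin_subst B)) q).
by rewrite line_expansion_subst Eq rmorphM /= map_polyXn.
Qed.

Lemma orthv_subst m k (B : 'M[K]_(m, k)) p a :
  orthv (p *m B^T) a = orthv p (a *m B).
Proof. by rewrite /orthv trmx_mul trmxK mulmxA. Qed.

Lemma dual_form_row_sub m k (B C : 'M[K]_(m, k)) j :
  dual_form (row j (B - C)) = dual_form (row j B) - dual_form (row j C).
Proof.
rewrite /dual_form -sumrB; apply: eq_bigr => i _.
by rewrite !mxE scalerBl.
Qed.

Lemma dual_form_row1 m (j : 'I_m) : dual_form (row j (1%:M : 'M[K]_m)) = 'X_j.
Proof.
rewrite /dual_form (bigD1 j) //= !mxE eqxx scale1r big1 ?addr0 // => i ij.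
by rewrite !mxE eq_sym (negbTE ij) scale0r.
Qed.

Lemma lin_substK m k (B : 'M[K]_(m, k)) (C : 'M[K]_(k, m)) :
  C *m B = 1%:M -> cancel (lin_subst C) (lin_subst B).
Proof.
move=> CB; apply: (mpoly_rmorphism_ext (F := lin_subst B \o lin_subst C) (G := idfun)).
  by move=> c /=; rewrite !lin_substC.
by move=> j /=; rewrite lin_substX lin_subst_dual -row_mul CB dual_form_row1.
Qed.

(** The hypothesis says that the variables are fixed modulo [dual_form a], and congruence modulo a
    form is stable under sums and products. *)
Lemma lin_subst_section_mod m k (B : 'M[K]_(m, k)) (C : 'M[K]_(k, m))
    (u : 'cV_m) (a : 'rV_m) :
  1%:M - B *m C = u *m a ->
  forall f, exists g, f - lin_subst C (lin_subst B f) = dual_form a * g.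
Proof.
move=> BC; apply: mpoly_ring_ind => [c|j|f g [f' Ef] [g' Eg]|f g [f' Ef] [g' Eg]].
- by exists 0; rewrite !lin_substC subrr mulr0.
- exists (u j 0)%:MP; rewrite lin_substX lin_subst_dual -row_mul.
  rewrite -(dual_form_row1 j) -dual_form_row_sub BC mulrC mul_mpolyC.
  rewrite /dual_form scaler_sumr.
  by apply: eq_bigr => i _; rewrite !mxE big_ord1 scalerA.
- by exists (f' + g'); rewrite mulrDr -Ef -Eg !rmorphD opprD addrACA.
exists (f * g' + f' * lin_subst C (lin_subst B g)).
rewrite mulrDr mulrCA -Eg mulrA -Ef !rmorphM mulrBr mulrBl.
by rewrite addrA subrK.
Qed.

(** [B] parametrizes the hyperplane a = 0 and [C] is a retraction onto it. Base change brings the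
    rank one matrix [a] to (1, 0, ..., 0), where both come from the last [k] coordinates. *)
Lemma hyperplane_param k (a : 'rV[K]_k.+1) : a != 0 ->
  exists (B : 'M_(k.+1, k)) (C : 'M_(k, k.+1)) (u : 'cV_k.+1),
    [/\ a *m B = 0, C *m B = 1%:M & 1%:M - B *m C = u *m a].
Proof.
rewrite -[k.+1]/(1 + k)%N in a * => a0.
have ra : \rank a = 1%N by rewrite rank_rV a0.
have := mulmx_ebase a; rewrite ra; set E := row_ebase a; set c := col_ebase a.
have pid : pid_mx 1 = row_mx 1%:M 0 :> 'M[K]_(1, 1 + k).
  rewrite -[LHS]hsubmxK; congr row_mx; apply/matrixP=> i j; rewrite !mxE.
    by rewrite !ord1.
  by rewrite !ord1.
rewrite pid => Ea.
have uE : E \in unitmx := row_ebase_unit a.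
have uc : c \in unitmx := col_ebase_unit a.
exists (invmx E *m col_mx 0 1%:M), (row_mx 0 1%:M *m E),
  (invmx E *m col_mx 1%:M 0 *m invmx c); split.
- by rewrite -Ea -!mulmxA mulKVmx // mul_row_col mulmx0 mul0mx addr0 mulmx0.
- by rewrite -mulmxA mulKVmx // mul_row_col mul0mx add0r mulmx1.
rewrite -[in RHS]Ea -!mulmxA mulKmx // !(mulmxA _ _ E).
apply/eqP; rewrite subr_eq -mulmxDl -mulmxDr !mul_col_row add_block_mx.
rewrite !(mulmx0, mul0mx, mulmx1, addr0, add0r).
by rewrite -scalar_mx_block mulmx1 mulVmx.
Qed.

End LinearSubstitution.

(* The ideal of d-fold products, split by whether the first form is a factor:
   the shape in which the induction lifts and recombines its members. *)
Fixpoint fold_rec (R : comNzRingType) (s : seq R) (d : nat) : R -> Prop :=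
  match d, s with
  | 0, _ => fun => True
  | d'.+1, [::] => fun f => f = 0
  | d'.+1, L :: s' => fun f => exists g h,
      [/\ fold_rec s' d'.+1 g, fold_rec s' d' h & f = g + L * h]
  end.

Lemma fold_rec0 (R : comNzRingType) (s : seq R) d : fold_rec s d 0.
Proof.
elim: s d => [|L s IH] [|d] //=.
by exists 0, 0; rewrite mulr0 addr0; split.
Qed.

(** [G] need not be a morphism: it only lifts the arbitrary cofactors reached at [d = 0], and the
    recursion reassembles them. *)
Lemma fold_rec_lift (R S : comNzRingType) (F : {rmorphism R -> S})
    (G : S -> R) (s : seq R) d f :
  cancel G F -> fold_rec (map F s) d f -> exists2 g, fold_rec s d g & F g = f.
Proof.
move=> GK; elim: s d f => [|L s IH] [|d] f.
- by exists (G f).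
- by move=> /= ->; exists 0; rewrite ?rmorph0.
- by exists (G f).
move=> /= [g [h [/IH[g' g'I <-] /IH[h' h'I <-] ->]]].
exists (g' + L * h'); last by rewrite rmorphD rmorphM.
by exists g', h'.
Qed.

(** * From order conditions to membership in the ideal of products *)

Section MainInduction.

Variable K : fieldType.

(** Of the [d] factors of a product, at most as many as there are forms nonzero at [p] fail to
    vanish there. *)
Lemma fold_rec_order k (p : 'rV[K]_k) (s : seq 'rV_k) d f :
  fold_rec (map (@dual_form K k) s) d f ->
  order_ge p f (d - count (predC (orthv p)) s).
Proof.
elim: s d f => [|a s IH] [|d] f; try by move=> _; apply: order_ge0.
  by move=> /= ->; apply: order_ge_poly0.
move=> /= [g [h [/IH og /IH oh ->]]]; apply: order_geD.
  by apply: order_ge_leq og; apply: leq_sub2l; apply: leq_addl.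
case pa: (orthv p a) => /=; last first.
  by rewrite add1n subSS; apply: order_ge_mull.
apply: order_ge_leq (order_geM (order_ge_dual pa) oh).
by rewrite add0n add1n leq_subLR addnS ltnS -leq_subLR.
Qed.

(** Subsequences count repetitions, since restriction to a hyperplane may make two forms
    coincide. *)
Definition generic_seq k (s : seq 'rV[K]_k.+1) : Prop :=
  forall t, subseq t s -> size t = k -> free t.

Lemma generic_seq_sub k (s s' : seq 'rV[K]_k.+1) :
  subseq s' s -> generic_seq s -> generic_seq s'.
Proof. by move=> ss' gs t /subseq_trans/(_ ss')/gs. Qed.

(** A relation among the restricted forms lifts to some [b] in the span of [t] that vanishes on the
    hyperplane, hence is a multiple of [a]; independence of [a :: t] gives [b = 0]. *)
Lemma generic_seq_restrict k (a : 'rV[K]_k.+2) (s : seq 'rV_k.+2)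
    (B : 'M_(k.+2, k.+1)) (C : 'M_(k.+1, k.+2)) (u : 'cV_k.+2) :
  1%:M - B *m C = u *m a -> generic_seq (a :: s) ->
  generic_seq [seq b *m B | b <- s].
Proof.
move=> BC gs _ /subseqP[m sm ->]; rewrite -map_mask size_map => st.
set t := mask m s in st *.
have /gs : subseq (a :: t) (a :: s) by rewrite /= eqxx mask_subseq.
rewrite /= st free_cons => /(_ erefl) /andP[a_t fr_t].
apply/(freeP (X := map_tuple (fun b => b *m B) (in_tuple t))) => c.
rewrite /=; set b := \sum_i c i *: t`_i => cB.
have bB : b *m B = 0.
  rewrite mulmx_suml -[RHS]cB; apply: eq_bigr => i _.
  by rewrite (nth_map 0) ?scalemxAl.
have Eb : b = (b *m u) 0 0 *: a.
  rewrite -mul_scalar_mx -mx11_scalar -mulmxA -BC mulmxBr mulmx1 mulmxA bB.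
  by rewrite mul0mx subr0.
have b_t : b \in <<t>>%VS.
  by apply: memv_suml => i _; rewrite memvZ // memv_span // mem_nth.
have b0 : b = 0.
  rewrite Eb; have [->|nz] := eqVneq ((b *m u) 0 0) 0; first by rewrite scale0r.
  by case/negP: a_t; rewrite -[a]scale1r -(mulVf nz) -scalerA -Eb memvZ.
exact: (freeP (X := in_tuple t) fr_t).
Qed.

(** In dimension one the line is the whole space: setting E = 0 and T = ['X_0] in the expansion
    recovers [f]. *)
Lemma order_ge1_dim1 f : order_ge (const_mx 1 : 'rV[K]_1) f 1 -> f = 0.
Proof.
move=> /Xn_dvd1P; rewrite -horner_coef0 => f0.
have ev : horner_eval ('X_0 : {mpoly K[1]}) \o horner_eval 0 \o
    line_expansion (const_mx 1) =1 idfun.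
  apply: mpoly_rmorphism_ext => [c|j] /=.
    by rewrite /horner_eval line_expansionC !hornerC.
  rewrite /horner_eval line_expansionX hornerD hornerMX hornerC mulr0 addr0.
  by rewrite mxE mpolyC1 scale1r hornerX ord1.
by have := ev f; rewrite /= /horner_eval f0 horner0.
Qed.

(* In K^(k+1) the truncated difference m.+1 - k is 0 exactly when m < k, and then
   p imposes no condition. *)
Lemma order_ge_mem_fold k (s : seq 'rV[K]_k.+1) f :
  generic_seq s ->
  (forall p : 'rV_k.+1, p != 0 -> order_ge p f ((count (orthv p) s).+1 - k)) ->
  fold_rec (map (@dual_form K k.+1) s) ((size s).+1 - k) f.
Proof.
elim: k s f => [|k IHk] s f.
  have nz : const_mx 1 != 0 :> 'rV[K]_1.
    by apply/eqP => /rowP/(_ 0)/eqP; rewrite !mxE oner_eq0.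
  move=> _ /(_ _ nz) of_; rewrite (order_ge1_dim1 (order_ge_leq _ of_)) //.
  exact: fold_rec0.
elim: s f => [|a s IHs] f gs of_; first by rewrite subSS sub0n.
(* With so few forms the required number of factors is 0 and the ideal is the whole ring. *)
have [szs|kle] := ltnP (size s) k.
  by have -> : ((size (a :: s)).+1 - k.+1 = 0)%N by apply/eqP; rewrite subn_eq0.
(* There are enough other forms to place [a] in a free family of [k.+1] vectors. *)
have a0 : a != 0.
  have /gs : subseq (a :: take k s) (a :: s) by rewrite /= eqxx take_subseq.
  rewrite /= size_takel // free_cons => /(_ erefl)/andP[a_t _].
  by apply: contraNneq a_t => ->; apply: mem0v.
have [B [C [u [aB CB BC]]]] := hyperplane_param a0.
have [g gI Eg] : exists2 g, fold_rec (map (@dual_form K k.+2) s)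
    ((size s).+1 - k) g & lin_subst B g = lin_subst B f.
  apply: (fold_rec_lift (lin_substK CB)).
  rewrite -map_comp (eq_map (g := @dual_form K k.+1 \o mulmx^~ B)); last first.
    by move=> b /=; rewrite lin_subst_dual.
  rewrite map_comp -(size_map (mulmx^~ B)); apply: IHk.
    exact: generic_seq_restrict BC gs.
  move=> p p0; apply: order_ge_subst.
  have p'0 : p *m B^T != 0.
    apply: contraNneq p0 => pB; rewrite -[p]mulmx1 -trmx1 -CB trmx_mul mulmxA.
    by rewrite pB mul0mx.
  (* On the hyperplane [a] itself vanishes, and this extra zero offsets the drop in dimension. *)
  apply: order_ge_leq (of_ _ p'0); rewrite /= orthv_subst aB /orthv mul0mx eqxx.
  rewrite add1n subSS count_map leq_sub2r // ltnS.
  by rewrite (eq_count (a2 := orthv (p *m B^T))) // => b /=; rewrite orthv_subst.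
have [h Eh] := lin_subst_section_mod BC (f - g).
rewrite rmorphB /= Eg subrr rmorph0 subr0 in Eh.
have hI : fold_rec (map (@dual_form K k.+2) s) ((size s).+1 - k.+1) h.
  apply: IHs; first exact: generic_seq_sub (subseq_cons s a) gs.
  move=> p p0; have: order_ge p (dual_form a * h) ((count (orthv p) (a :: s)).+1 - k.+1).
    rewrite -Eh; apply: order_geD (of_ p p0) (order_geN _).
    (* The zeros of [s] at [p] already give [g] the order required of [f], as [a] adds at most one
       zero. *)
    apply: order_ge_leq (fold_rec_order p gI).
    rewrite -(count_predC (orthv p) s) subnAC -addSn addnK /= subSS.
    by rewrite leq_sub2r // -[X in (_ <= X)%N]add1n leq_add2r leq_b1.
  rewrite /= subSS; case pa: (orthv p a); last first.
    by rewrite add0n subSS; apply: order_ge_cancel; rewrite pa.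
  rewrite add1n subSS.
  (* Below [k] zeros the condition on [h] is void; from [k] on the subtraction is exact and dividing
     by the form costs one order. *)
  have [lt|le] := ltnP (count (orthv p) s) k.
    by move=> _; apply: order_ge_leq (order_ge0 _ _); rewrite leqn0 subn_eq0 ltnW.
  rewrite subSn //; exact: order_ge_cancel_orth.
rewrite /= subSS subSn //; exists g, h; split=> //.
- by rewrite -subSn.
- by rewrite -Eh addrC subrK.
Qed.

End MainInduction.

(** * Ideals presented by generators *)

Section IdealGen.

Variable R : comNzRingType.
Implicit Types (G Q : R -> Prop) (f g c : R).

Lemma ideal_gen_ind G Q :
  Q 0 -> (forall f g, Q f -> Q g -> Q (f + g)) ->
  (forall c g, G g -> Q (c * g)) -> forall f, ideal_gen G f -> Q f.
Proof.
move=> Q0 QD QG f [m [c [g [Gg ->]]]]; apply: big_ind => // i _.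
exact: QG.
Qed.

Lemma ideal_gen0 G : ideal_gen G 0.
Proof. by exists 0%N, (fun=> 0), (fun=> 0); split; [case | rewrite big_ord0]. Qed.

Lemma ideal_genD G f g : ideal_gen G f -> ideal_gen G g -> ideal_gen G (f + g).
Proof.
move=> [m [c [u [Gu ->]]]] [m' [c' [u' [Gu' ->]]]].
pose glue (T : Type) (v : 'I_m -> T) (v' : 'I_m' -> T) i :=
  match split i with inl j => v j | inr j => v' j end.
exists (m + m')%N, (glue R c c'), (glue R u u'); split.
  by move=> i; rewrite /glue; case: (split i).
rewrite big_split_ord /glue /=; congr (_ + _); apply: eq_bigr => i _.
  by rewrite (unsplitK (inl i)).
by rewrite (unsplitK (inr i)).
Qed.

Lemma ideal_gen_mul G c g : G g -> ideal_gen G (c * g).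
Proof.
by move=> Gg; exists 1%N, (fun=> c), (fun=> g); rewrite big_ord1.
Qed.

(** Keeping [S] inside [r] ensures, by [uniq r], that the head index is new when it is added to a
    set from the tail. *)
Lemma fold_rec_ideal_gen n (L : 'I_n -> R) (r : seq 'I_n) d f :
  uniq r -> fold_rec (map L r) d f ->
  ideal_gen (fun g => exists S : {set 'I_n},
    [/\ #|S| = d, {subset S <= r} & g = \prod_(i in S) L i]) f.
Proof.
have fold0 r' f' : ideal_gen (fun g => exists S : {set 'I_n},
    [/\ #|S| = 0, {subset S <= r'} & g = \prod_(i in S) L i]) f'.
  rewrite -[f']mulr1; apply: ideal_gen_mul; exists set0.
  by rewrite cards0 big_set0; split=> // i; rewrite inE.
elim: r d f => [|a r IH] [|d] f //=; first by move=> _ ->; apply: ideal_gen0.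
move=> /andP[ar ur] [g [h [/(IH _ _ ur) gI /(IH _ _ ur) hI ->]]].
apply: ideal_genD.
  elim/ideal_gen_ind: gI => [|f1 f2|c _ [S [cS Sr ->]]].
  - exact: ideal_gen0.
  - exact: ideal_genD.
  apply: ideal_gen_mul; exists S; split=> // i /Sr ir.
  by rewrite inE ir orbT.
elim/ideal_gen_ind: hI => [|f1 f2 I1 I2|c _ [S [cS Sr ->]]].
- by rewrite mulr0; apply: ideal_gen0.
- by rewrite mulrDr; apply: ideal_genD.
have aS : a \notin S by apply: contra ar => /Sr.
rewrite mulrCA; apply: ideal_gen_mul; exists (a |: S).
rewrite cardsU1 aS cS big_setU1 //; split=> // i.
by rewrite !inE => /predU1P[->|/Sr ->]; rewrite ?eqxx ?orbT.
Qed.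

End IdealGen.

(** * Linear forms as dot products *)

Section DotForm.

Variables (K : fieldType) (k : nat).
Implicit Types (p q a : 'rV[K]_k.+1).

Definition dotp p a : K^o := (a *m p^T) 0 0.

Lemma dotp_is_linear p : linear (dotp p).
Proof. by move=> c a b; rewrite /dotp mulmxDl -scalemxAl !mxE. Qed.

HB.instance Definition _ p :=
  GRing.isLinear.Build K 'rV[K]_k.+1 K^o *:%R (dotp p) (dotp_is_linear p).

Definition dot_form p : linear_form K k.+1 := linfun (dotp p).

Lemma dot_formE p a : dot_form p a = (a *m p^T) 0 0.
Proof. by rewrite lfunE. Qed.

Lemma orthvE p a : orthv p a = (a \in lker (dot_form p)).
Proof.
rewrite memv_ker dot_formE /orthv; apply/eqP/eqP => [->|pa]; first by rewrite mxE.
by apply/matrixP => i j; rewrite !ord1 pa mxE.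
Qed.

Lemma dot_form_surj (l : linear_form K k.+1) : exists p, l = dot_form p.
Proof.
exists (\row_j l (delta_mx 0 j)); apply/lfunP => a.
rewrite dot_formE [a in LHS]row_sum_delta linear_sum mxE; apply: eq_bigr => j _.
by rewrite linearZ !mxE.
Qed.

Lemma dot_form_eq0 p : (dot_form p == 0) = (p == 0).
Proof.
apply/eqP/eqP => [p0|->].
  apply/rowP => j; rewrite mxE; have := dot_formE p (delta_mx 0 j).
  rewrite p0 lfunE /= mxE (bigD1 j) //= !mxE !eqxx mul1r big1 ?addr0 // => i ij.
  by rewrite !mxE (negbTE ij) andbF mul0r.
by apply/lfunP => a; rewrite dot_formE lfunE trmx0 mulmx0 mxE.
Qed.

Lemma dim_lker_dot_form p : p != 0 -> \dim (lker (dot_form p)) = k.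
Proof.
rewrite -dot_form_eq0 => p0; have := limg_ker_dim (dot_form p) fullv.
rewrite capfv dimvf /dim /= mul1n => E.
have : (0 < \dim (limg (dot_form p)))%N.
  rewrite lt0n dimv_eq0 -lkerE; apply: contra p0 => /subvP le.
  apply/eqP/lfunP => a; have := le a (memvf a).
  by rewrite memv_ker => /eqP ->; rewrite lfunE.
have := dimvS (subvf (limg (dot_form p))); rewrite dimvf /dim /=.
by move=> le gt; move: E; have -> : \dim (limg (dot_form p)) = 1%N;
  [apply/eqP; rewrite eqn_leq le gt | rewrite addn1 => -[]].
Qed.

(** For [w] outside [U], some coordinate of [w - projv U w] is nonzero; that coordinate of
    [a - projv U a] is a form killing [U] but not [w]. *)
Lemma proper_subspace_orth (U : {vspace 'rV[K]_k.+1}) : (\dim U < k.+1)%N ->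
  exists2 p, p != 0 & forall a, a \in U -> orthv p a.
Proof.
move=> dimU; have [w wU] : exists w, w \notin U.
  have nz : vpick (U^C) != 0.
    rewrite vpick0 -dimv_eq0 dimv_compl dimvf /dim /= mul1n.
    by rewrite -lt0n subn_gt0.
  exists (vpick (U^C)); apply: contra nz => wU.
  by rewrite -memv0 -(capv_compl U) memv_cap wU memv_pick.
pose v := w - projv U w.
have /rV0Pn[j vj] : v != 0.
  by apply: contra wU; rewrite subr_eq0 => /eqP ->; apply: memv_proj.
have [p Ep] := dot_form_surj (dot_form (delta_mx 0 j) \o (\1 - projv U))%VF.
have Epa a : dot_form p a = dot_form (delta_mx 0 j) (a - projv U a).
  by rewrite -Ep comp_lfunE !lfunE /= !lfunE.
exists p => [|a aU].
  apply: contraNneq vj => p0; have := Epa w.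
  have /eqP -> : dot_form p == 0 by rewrite dot_form_eq0 p0.
  rewrite lfunE /= dot_formE -/v mxE (bigD1 j) //= !mxE !eqxx mulr1 big1.
    by rewrite addr0 => <-.
  by move=> i ij; rewrite !mxE (negbTE ij) andbF mulr0.
by rewrite orthvE memv_ker Epa projv_id // subrr linear0.
Qed.

End DotForm.

(** * Nilpotency index of a generic arrangement in coordinates *)

Section Configuration.

Variables (K : fieldType) (k n : nat) (x : 'I_n -> 'rV[K]_k.+1).
Implicit Types (p q : 'rV[K]_k.+1) (f : {mpoly K[k.+1]}).

Let L i := dual_form (x i).
Let I := fold_ideal (fun i => dual_form (x i)) (n.+1 - k).

Definition zeros p : {set 'I_n} := [set i | orthv p (x i)].

Hypothesis generic : forall S : {set 'I_n},
  #|S| = k -> free [seq x i | i <- enum S].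
Hypothesis spanning : forall p, p != 0 -> exists i, i \notin zeros p.

Let s := [seq x i | i <- enum 'I_n].

Lemma generic_enum : generic_seq s.
Proof.
move=> _ /subseqP[m sm ->]; rewrite -map_mask size_map => szr.
set r := mask m (enum 'I_n) in szr *.
have ur : uniq r by rewrite mask_uniq ?enum_uniq.
have := @generic [set i in r]; rewrite cardsE (card_uniqP ur) => /(_ szr).
have rS : perm_eq (enum [set i in r]) r.
  by apply: uniq_perm; rewrite ?enum_uniq // => i; rewrite mem_enum inE.
by rewrite (perm_free (perm_map x rS)).
Qed.

Lemma count_orth p : count (orthv p) s = #|zeros p|.
Proof.
rewrite count_map cardsE cardE -size_filter enumT; congr size.
Qed.

Lemma size_config : size s = n.
Proof. by rewrite size_map size_enum_ord. Qed.

(** At most [k] vectors span a proper subspace, so a nonzero [p] would be orthogonal to all of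
    them. *)
Lemma config_large : (k < n)%N.
Proof.
rewrite -size_config ltnNge; apply/negP => szs.
have dim_s : (\dim <<s>> < k.+1)%N by rewrite ltnS (leq_trans (dim_span s)).
have [p p0 ps] := proper_subspace_orth dim_s.
have [i] := spanning p0; rewrite inE ps // memv_span // map_f //.
by rewrite mem_enum.
Qed.

Lemma order_ge_mem_fold_ideal f :
  (forall p, p != 0 -> order_ge p f (#|zeros p|.+1 - k)) -> I f.
Proof.
move=> of_; have : fold_rec (map L (enum 'I_n)) (n.+1 - k) f.
  have := order_ge_mem_fold (f := f) generic_enum.
  rewrite size_config -map_comp; apply=> p p0.
  by rewrite count_orth; apply: of_.
move=> /(fold_rec_ideal_gen (enum_uniq _)).
apply: ideal_gen_ind => [|f1 f2|c _ [S [cS _ ->]]].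
- exact: ideal_gen0.
- exact: ideal_genD.
by apply: ideal_gen_mul; exists S.
Qed.

Lemma fold_ideal_order_ge p f : I f -> order_ge p f (#|zeros p|.+1 - k).
Proof.
apply: (ideal_gen_ind (Q := fun f => order_ge p f (#|zeros p|.+1 - k)))
  => [|f1 f2|c _ [S [cS ->]]].
- exact: order_ge_poly0.
- exact: order_geD.
apply: order_ge_mull.
apply: (order_ge_leq (e := \sum_(i in S) orthv p (x i))); last first.
  apply: order_ge_prod => i _.
  by case pi: (orthv p (x i)); [apply: order_ge_dual | apply: order_ge0].
have -> : (\sum_(i in S) orthv p (x i) = #|S :&: zeros p|)%N.
  rewrite -sum1_card [RHS](eq_bigl (fun i => (i \in S) && orthv p (x i))).
    by rewrite [RHS]big_mkcondr; apply: eq_bigr => i _; case: orthv.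
  by move=> i; rewrite !inE.
(* Inclusion-exclusion: [S] and [zeros p] lie in a set of [n] indices, and [S] has [n.+1 - k] of
   them. *)
rewrite leq_subLR -(leq_add2l n) addnS -addSn addnCA.
rewrite -{1}(subnK (leqW (ltnW config_large))) -cS addnAC addnC leq_add2l -cardsUI.
by rewrite leq_add2r -[X in (_ <= X)%N]card_ord max_card.
Qed.

(** [K] may be infinite, so the maximum is taken over the finitely many index sets whose vectors
    span a proper subspace: each [zeros q] is one, and each lies in some [zeros p]. *)
Lemma max_zeros : exists2 p, p != 0 &
  forall q, q != 0 -> (#|zeros q| <= #|zeros p|)%N.
Proof.
pose small (S : {set 'I_n}) := (\dim <<[seq x i | i <- enum S]>> < k.+1)%N.
have small0 : small set0 by rewrite /small enum_set0 /= span_nil dimv0.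
case: (arg_maxnP (fun S : {set 'I_n} => #|S|) small0) => S smallS maxS.
have [p p0 pS] := proper_subspace_orth smallS.
exists p => // q q0; apply: leq_trans (_ : #|S| <= _)%N.
  apply: maxS; rewrite /small ltnS.
  rewrite -[X in (_ <= X)%N](dim_lker_dot_form q0); apply: dimvS.
  apply/span_subvP => a /mapP[i]; rewrite mem_enum inE => qi ->.
  by rewrite -orthvE.
apply: subset_leq_card; apply/subsetP => i iS.
by rewrite inE pS // memv_span // map_f // mem_enum.
Qed.

(** Any [k] of the vectors span a proper subspace, hence are orthogonal to a common nonzero [q]. *)
Lemma max_zeros_ge p :
  (forall q, q != 0 -> (#|zeros q| <= #|zeros p|)%N) -> (k <= #|zeros p|)%N.
Proof.
move=> maxp; pose t := take k s.
have szt : size t = k by rewrite size_takel // size_config ltnW // config_large.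
have [q q0 qt] : exists2 q, q != 0 & forall a, a \in <<t>>%VS -> orthv q a.
  apply: proper_subspace_orth; rewrite ltnS -[X in (_ <= X)%N]szt.
  exact: dim_span.
apply: leq_trans (maxp q q0); rewrite -count_orth -[X in (X <= _)%N]szt.
rewrite -[s](cat_take_drop k) count_cat -/t.
have /eqP -> : count (orthv q) t == size t.
  by rewrite -all_count; apply/allP => a at_; rewrite qt // memv_span.
exact: leq_addr.
Qed.

(* As linear forms, p and q have the same kernel: the span of any k of the x i
   with i in zeros q. *)
Lemma zeros_subset_eq p q : p != 0 -> q != 0 -> (k <= #|zeros q|)%N ->
  zeros q \subset zeros p -> zeros p \subset zeros q.
Proof.
move=> p0 q0 kq qp.
pose S := [set i in take k (enum (zeros q))].
have uS : uniq (take k (enum (zeros q))) by rewrite take_uniq ?enum_uniq.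
have cS : #|S| = k.
  by rewrite cardsE (card_uniqP uS) size_takel // -cardE.
have Sq : S \subset zeros q.
  by apply/subsetP => i; rewrite inE => /mem_take; rewrite mem_enum.
set U := <<[seq x i | i <- enum S]>>%VS.
have dimU : \dim U = k.
  by have /eqP -> := generic cS; rewrite size_map -cardE.
have UE r : r != 0 -> S \subset zeros r -> U = lker (dot_form r).
  move=> r0 /subsetP Sr; apply/eqP; rewrite eqEdim dimU dim_lker_dot_form //.
  rewrite leqnn andbT; apply/span_subvP => a /mapP[i].
  by rewrite mem_enum => /Sr; rewrite inE orthvE => ? ->.
apply/subsetP => i; rewrite !inE !orthvE -(UE q) // -(UE p) //.
exact: subset_trans Sq qp.
Qed.

Lemma fold_ideal_nilpotency p : p != 0 ->
  (forall q, q != 0 -> (#|zeros q| <= #|zeros p|)%N) ->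
  (forall i, x i != 0) ->
  is_nil I (#|zeros p|.+1 - k).
Proof.
move=> p0 maxp x0; have kp := max_zeros_ge maxp.
have radI_order q f : (k <= #|zeros q|)%N -> ideal_radical I f -> order_ge q f 1.
  move=> kq [m /(fold_ideal_order_ge q)].
  by move=> /(order_ge_leq (e' := 1)); rewrite subn_gt0 ltnS => /(_ kq)/order_ge1_root.
split=> [f fJ|t It].
  apply: order_ge_mem_fold_ideal => q q0.
  have [lt|kq] := ltnP #|zeros q| k.
    by apply: order_ge_leq (order_ge0 _ _); rewrite leqn0 subn_eq0.
  apply: (order_ge_leq (e := #|zeros p|.+1 - k)).
    by rewrite leq_sub2r // ltnS maxp.
  elim/ideal_gen_ind: fJ => [|f1 f2|c _ [g [gJ ->]]].
  - exact: order_ge_poly0.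
  - exact: order_geD.
  apply: order_ge_mull; apply: order_ge_prod1 => i.
  exact: radI_order.
rewrite leqNgt; apply/negP => t_lt.
(* [t = 0] would put 1 in the ideal, but 1 has order 0 along [p]. *)
have [t0|t_gt0] := posnP t.
  have /(fold_ideal_order_ge p) : I 1.
    apply: It; rewrite t0 -[1]mulr1; apply: ideal_gen_mul.
    by exists (fun=> 0); rewrite big_ord0; split=> // -[].
  move=> /(order_ge_leq (e' := 1)); rewrite subn_gt0 ltnS => /(_ kp)/Xn_dvd1P.
  by rewrite rmorph1 coef1 => /eqP; rewrite oner_eq0.
(* In dimension one [zeros p] is empty and the threshold is 1; a positive [t] below the threshold
   excludes this. *)
have /card_gt0P[j] : (0 < #|zeros p|)%N.
  rewrite -ltnS; apply: leq_trans (leq_subr k _); exact: leq_ltn_trans t_gt0 t_lt.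
rewrite inE => pj.
pose N := \prod_(i | i \notin zeros p) L i.
have N_order : ~ order_ge p N 1.
  by move=> /order_ge_prod_dual[i]; rewrite inE => /negP.
have f_rad : ideal_radical I (L j * N).
  (* The exponent [n.+1] bounds every threshold [#|zeros q|.+1 - k]. *)
  exists n.+1; apply: order_ge_mem_fold_ideal => q q0.
  have [lt|kq] := ltnP #|zeros q| k.
    by apply: order_ge_leq (order_ge0 _ _); rewrite leqn0 subn_eq0.
  have f_order : order_ge q (L j * N) 1.
    (* Either [zeros q] equals [zeros p] by genericity, so [L j] vanishes at [q], or a factor of [N]
       does. *)
    have [qp|/subsetPn[i]] := boolP (zeros q \subset zeros p).
      rewrite mulrC; apply/order_ge_mull/order_ge_dual.
      by have /subsetP/(_ j) := zeros_subset_eq p0 q0 kq qp; rewrite !inE; apply.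
    rewrite inE => qi pi; apply: order_ge_mull; rewrite /N (bigD1 i) //= mulrC.
    exact/order_ge_mull/order_ge_dual.
  apply: (order_ge_leq (e := n.+1)).
    by rewrite (leq_trans (leq_subr _ _)) // ltnS (leq_trans (max_card _)) ?card_ord.
  rewrite -[X in _ ^+ X](card_ord n.+1) -prodr_const.
  by apply: order_ge_prod1 => i.
have /(fold_ideal_order_ge p)/(order_ge_leq t_lt) : I ((L j * N) ^+ t).
  apply: It; rewrite -[_ ^+ t]mul1r; apply: ideal_gen_mul.
  by exists (fun=> L j * N); rewrite prodr_const card_ord.
(* Cancelling the [t] factors [L j] costs one order each and leaves order 1 for [N ^+ t]. The
   induction varies their number while the exponent of [N] stays fixed. *)
rewrite exprMn -[t.+1]addn1 => ot; apply: N_order.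
apply: (order_ge1_root (m := t)); elim: {1 3}t ot => [|e IH].
  by rewrite mul1r.
by rewrite exprS -mulrA addSn => /(order_ge_cancel_orth (x0 j) pj).
Qed.

End Configuration.

End FoldIdeals.

(** * Passage from coordinate vectors to projective points *)

Import GRing.Theory.

Theorem theorem3p2 (K : fieldType) (k n : nat) (P : 'I_n -> proj K k)
    (x : 'I_n -> 'rV[K]_k) :
  (0 < k)%N ->
  injective P ->
  ~ in_some_hyperplane P ->
  generic_km2 P ->
  (forall i, homog_coord (P i) (x i)) ->
  exists h s : nat,
    [/\ is_hyp P h,
        is_nil (fold_ideal (fun i => dual_form (x i)) (n - k + 2)) s
      & (h%:Z = s%:Z + k%:Z - 2)%R].
Proof.
case: k P x => [//|k] P x _ _ not_in_hyp gen_P hx.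
have generic (S : {set 'I_n}) : #|S| = k -> free [seq x i | i <- enum S].
  exact: gen_P x hx S.
have onE p i : on_hyperplane (dot_form p) (P i) = (i \in zeros x p).
  by rewrite inE orthvE /on_hyperplane hx memvE.
have points_onE p : points_on P (dot_form p) = zeros x p.
  by apply/setP => i; rewrite inE onE.
have spanning p : p != 0%R -> exists i, i \notin zeros x p.
  move=> p0; have [/existsP //|none] := boolP [exists i, i \notin zeros x p].
  case: not_in_hyp; exists (dot_form p); split; first by rewrite dot_form_eq0.
  by move=> i; rewrite onE; apply: contraR none => pi; apply/existsP; exists i.
have x_neq0 i : x i != 0%R.
  by have := valP (P i); rewrite /= hx dim_vline eqb1.
have [p p0 maxp] := max_zeros x.
have k_lt_n : (k < n)%N := config_large spanning.
have k_le_h : (k <= #|zeros x p|)%N := max_zeros_ge spanning maxp.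
exists #|zeros x p|, (#|zeros x p|.+1 - k)%N; split.
- split; first by exists (dot_form p); rewrite dot_form_eq0 points_onE.
  move=> l; have [q ->] := dot_form_surj l.
  by rewrite dot_form_eq0 points_onE; apply: maxp.
(* Here [k] is one less than the ambient dimension, and [k < n] keeps the subtraction exact. *)
- have -> : n - k.+1 + 2 = n.+1 - k.
    by rewrite addn2 subnS prednK ?subn_gt0 // subSn // ltnW.
  exact: fold_ideal_nilpotency.
(* Moving 2 across leaves an identity of naturals, where [k <= #|zeros x p|] undoes the truncated
   subtraction. *)
apply: (addIr (Posz 2)); rewrite subrK -!PoszD; congr Posz.
by rewrite addn2 addnS subnK // leqW.
Qed.
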